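(* For every natural number $m\ge 1$, $$\varpi_m = \frac{2(m+2)}{m}\prod_{n=1}^\infty \frac{2n(2mn+m+2)}{(2n+1)(2mn+2)}.$$
   Context: For a natural number $m\ge 1$, the real number $\varpi_m$ is defined by the (improper, convergent) integral $$\varpi_m = 2\int_0^1 \frac{dt}{\sqrt{1-t^m}}.$$ The infinite product is understood as the limit of its partial products $\prod_{n=1}^N$ as $N\to\infty$. *)

(* Defs.v *)
From Stdlib Require Import Reals Lra Lia.
From Coquelicot Require Import Coquelicot.
Open Scope R_scope.

(* Improper Riemann integral: the upper endpoint tends to 1 from the left.
   [RInt_gen] is total; [varpi_integral_converges] below shows that for
   [1 <= m] it is the value of a convergent integral. *)
Definition varpi (m : nat) : R :=
  2 * RInt_gen (fun t : R => 1 / sqrt (1 - t ^ m)) (at_point 0) (at_left 1).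

(* a 1 * a 2 * ... * a N; the value a 0 is never used. *)
Fixpoint partial_prod (a : nat -> R) (N : nat) : R :=
  match N with
  | O => 1
  | S k => partial_prod a k * a (S k)
  end.

Definition is_inf_prod (a : nat -> R) (P : R) : Prop :=
  is_lim_seq (partial_prod a) (Finite P).

Lemma varpi_pow_bound (m : nat) (t : R) :
  (1 <= m)%nat -> 0 <= t < 1 -> 0 <= t ^ m <= t.
Proof.
  intros Hm Ht; split.
  - apply pow_le; lra.
  - destruct m as [|m]; [lia|]; simpl.
    assert (H : t ^ m <= 1) by (rewrite <- (pow1 m); apply pow_incr; lra).
    nra.
Qed.

Lemma varpi_ex_RInt (m : nat) (a b : R) :
  (1 <= m)%nat -> 0 <= a <= b -> b < 1 ->
  ex_RInt (fun t : R => 1 / sqrt (1 - t ^ m)) a b.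
Proof.
  intros Hm Ha Hb.
  apply (ex_RInt_continuous (V := R_CompleteNormedModule)).
  intros z Hz; rewrite Rmin_left, Rmax_right in Hz by lra.
  assert (Hp := varpi_pow_bound m z Hm ltac:(lra)).
  apply (ex_derive_continuous (V := R_NormedModule)).
  assert (Hs : 0 < sqrt (1 - z ^ m)) by (apply sqrt_lt_R0; lra).
  auto_derive; unfold Rminus in *; repeat split; lra.
Qed.

Lemma varpi_RInt_bound (m : nat) (x : R) :
  (1 <= m)%nat -> 0 <= x < 1 ->
  RInt (fun t : R => 1 / sqrt (1 - t ^ m)) 0 x <= 2.
Proof.
  intros Hm Hx.
  assert (HI : is_RInt (fun t => 1 / sqrt (1 - t)) 0 x
                 (minus (- 2 * sqrt (1 - x)) (- 2 * sqrt (1 - 0)))).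
  { apply (is_RInt_derive (V := R_CompleteNormedModule)
             (fun t => - 2 * sqrt (1 - t)));
      intros t Ht; rewrite Rmin_left, Rmax_right in Ht by lra;
      assert (Hs : 0 < sqrt (1 - t)) by (apply sqrt_lt_R0; lra).
    - auto_derive; [lra|].
      unfold Rminus in *; field; lra.
    - apply (ex_derive_continuous (V := R_NormedModule)).
      auto_derive; unfold Rminus in *; repeat split; lra. }
  apply Rle_trans with (RInt (fun t => 1 / sqrt (1 - t)) 0 x).
  - apply RInt_le; [lra| apply varpi_ex_RInt; (lia || lra) | eexists; exact HI |].
    intros t Ht.
    assert (Hp := varpi_pow_bound m t Hm ltac:(lra)).
    unfold Rdiv; rewrite !Rmult_1_l.
    apply Rinv_le_contravar; [apply sqrt_lt_R0; lra | apply sqrt_le_1; lra].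
  - rewrite (is_RInt_unique _ _ _ _ HI).
    rewrite Rminus_0_r, sqrt_1; unfold minus, plus, opp; simpl.
    assert (Hs := sqrt_pos (1 - x)); lra.
Qed.

Lemma varpi_integral_converges (m : nat) : (1 <= m)%nat ->
  ex_RInt_gen (fun t : R => 1 / sqrt (1 - t ^ m)) (at_point 0) (at_left 1).
Proof.
  intros Hm.
  set (f := fun t : R => 1 / sqrt (1 - t ^ m)).
  destruct (completeness (fun y => exists x, 0 <= x < 1 /\ y = RInt f 0 x))
    as [l [Hub Hlub]].
  - exists 2; intros y [x [Hx ->]]; now apply varpi_RInt_bound.
  - exists (RInt f 0 0), 0; split; [lra | reflexivity].
  - assert (Hinc : forall x y, 0 <= x <= y -> y < 1 -> RInt f 0 x <= RInt f 0 y).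
    { intros x y Hxy Hy.
      rewrite <- (RInt_Chasles f 0 x y) by (apply varpi_ex_RInt; (lia || lra)).
      assert (0 <= RInt f x y).
      { apply RInt_ge_0; [lra | apply varpi_ex_RInt; (lia || lra) |].
        intros t Ht; unfold f.
        assert (Hp := varpi_pow_bound m t Hm ltac:(lra)).
        apply Rlt_le, Rdiv_lt_0_compat; [lra | apply sqrt_lt_R0; lra]. }
      unfold plus; simpl; lra. }
    exists l; intros P [eps HP].
    assert (Hx0 : exists x0, 0 <= x0 < 1 /\ l - eps < RInt f 0 x0).
    { destruct (Classical_Prop.classic
                  (exists x0, 0 <= x0 < 1 /\ l - eps < RInt f 0 x0)) as [H|H];
        [exact H|exfalso].
      assert (l <= l - eps).
      { apply Hlub; intros y [x [Hx ->]].
        apply Rnot_lt_le; intros Hlt; apply H; now exists x. }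
      assert (He := cond_pos eps); lra. }
    destruct Hx0 as [x0 [Hx0 Hlt]].
    apply (Filter_prod _ _ _ (fun a => a = 0) (fun b => x0 < b < 1)).
    + reflexivity.
    + assert (Hd : 0 < 1 - x0) by lra.
      exists (mkposreal _ Hd); intros y Hy Hy1.
      unfold ball in Hy; simpl in Hy; unfold AbsRing_ball, abs, minus, plus, opp in Hy;
        simpl in Hy.
      apply Rabs_def2 in Hy; lra.
    + intros a b -> Hb; exists (RInt f 0 b); split; simpl.
      * apply (RInt_correct (V := R_CompleteNormedModule)).
        apply varpi_ex_RInt; (lia || lra).
      * apply HP.
        assert (H1 := Hinc x0 b ltac:(lra) ltac:(lra)).
        assert (H2 : RInt f 0 b <= l) by (apply Hub; exists b; split; [lra|reflexivity]).
        unfold ball; simpl; unfold AbsRing_ball, abs, minus, plus, opp; simpl.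
        apply Rabs_def1; lra.
Qed.

(* Main.v *)
Require Import Defs.
From Stdlib Require Import Reals Lra Lia.
From Coquelicot Require Import Coquelicot.
Open Scope R_scope.

(** This is Wallis's argument, run on the integrals
    [moment m a] = [int_0^1 t^a sqrt (1 - t^m) dt] =: K(a).

    Integrating the derivative of [t^(a+1) (1 - t^m)^(3/2)] over [0, 1] gives
    the recurrence (2a + 2) K(a) = (2a + 2 + 3m) K(a + m) ([moment_step]).
    Along the exponents a = mN it yields the quotients
    (2mn + m + 2) / (2mn - 2m + 2), and along a = mN + m - 1, where the
    starting value K(m - 1) = 2 / (3m) is elementary ([moment_pred]), the
    quotients 2n / (2n + 3).  Up to shifts of the denominators, which
    telescope, their product is the n-th factor, so ([partial_prod_moment]) the
    N-th partial product equals

      K(0) * (m (2N + 3) / (2mN + 2)) * (K(mN + m - 1) / K(mN)).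

    Since K is decreasing, the last quotient lies between
    K(mN + m) / K(mN) = (2mN + 2) / (2mN + 2 + 3m) and 1, so the product
    converges to K(0) ([partial_prod_bound]).  Finally, integrating the
    derivative of [t sqrt (1 - t^m)] relates K(0) to the improper integral:
    [varpi m] = 2 (1 + 2/m) K(0) ([varpi_moment]).

    The weight sqrt (1 - t^m) is used rather than 1 / sqrt (1 - t^m) because
    its moments are proper integrals; the improper integral then appears only
    in the last relation. *)

(** * The moments of the weight sqrt (1 - t^m) *)

Definition moment (m a : nat) : R :=
  RInt (fun t : R => t ^ a * sqrt (1 - t ^ m)) 0 1.

(** Although [sqrt] is not differentiable at 0, [y^(3/2)] is, with derivative
    0; as [sqrt] vanishes on the negative reals, the formula holds on the whole
    line.  This makes the fundamental theorem of calculus applicable up to the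
    endpoint t = 1. *)
Lemma is_derive_mult_sqrt (y : R) :
  is_derive (fun y => y * sqrt y) y (3 / 2 * sqrt y).
Proof.
  destruct (Rtotal_order y 0) as [Hy|[->|Hy]].
  - rewrite sqrt_neg_0 by lra.
    apply (is_derive_ext_loc (fun _ => 0)).
    + apply (filter_imp (fun z => z < 0)); [|now apply (open_lt 0)].
      intros z Hz; rewrite sqrt_neg_0 by lra; symmetry; apply Rmult_0_r.
    + replace (3 / 2 * 0) with 0 by ring.
      apply (is_derive_const (K := R_AbsRing) (V := R_NormedModule)).
  - rewrite sqrt_0, Rmult_0_r.
    apply is_derive_Reals; intros eps Heps.
    destruct (continuous_sqrt 0 (ball (sqrt 0) eps)) as [d Hd].
    { now exists (mkposreal eps Heps). }
    exists d; intros h Hh Hhd.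
    specialize (Hd h); rewrite sqrt_0 in Hd |- *.
    rewrite Rplus_0_l.
    replace ((h * sqrt h - 0 * 0) / h - 0) with (sqrt h - 0) by (field; exact Hh).
    apply Hd; change (Rabs (h - 0) < d); now rewrite Rminus_0_r.
  - assert (Hs := sqrt_lt_R0 y Hy).
    auto_derive; [lra|].
    assert (Hq := sqrt_sqrt y (Rlt_le _ _ Hy)).
    apply (Rmult_eq_reg_r (2 * sqrt y)); [|lra].
    field_simplify; [|lra].
    simpl; nra.
Qed.

Lemma is_derive_one_minus_pow (m : nat) (t : R) :
  is_derive (fun t => 1 - t ^ m) t (- (INR m * t ^ pred m)).
Proof. auto_derive; [trivial|ring]. Qed.

Lemma is_derive_pow_three_halves (m : nat) (t : R) :
  is_derive (fun t => (1 - t ^ m) * sqrt (1 - t ^ m)) t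
    (- (3 / 2 * INR m) * (t ^ pred m * sqrt (1 - t ^ m))).
Proof.
  replace (- (3 / 2 * INR m) * (t ^ pred m * sqrt (1 - t ^ m)))
    with (- (INR m * t ^ pred m) * (3 / 2 * sqrt (1 - t ^ m))) by ring.
  apply (is_derive_comp (fun y => y * sqrt y) (fun t => 1 - t ^ m)).
  - apply is_derive_mult_sqrt.
  - apply is_derive_one_minus_pow.
Qed.

Lemma continuous_moment_integrand (m a : nat) (t : R) :
  continuous (fun t => t ^ a * sqrt (1 - t ^ m)) t.
Proof.
  apply (continuous_mult (K := R_AbsRing) (fun t => t ^ a)).
  - apply (ex_derive_continuous (V := R_NormedModule)); auto_derive; trivial.
  - apply (continuous_comp (fun t => 1 - t ^ m) sqrt).
    + apply (ex_derive_continuous (V := R_NormedModule)); auto_derive; trivial.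
    + apply continuous_sqrt.
Qed.

Lemma ex_RInt_moment_integrand (m a : nat) (x y : R) :
  ex_RInt (fun t => t ^ a * sqrt (1 - t ^ m)) x y.
Proof.
  apply (ex_RInt_continuous (V := R_CompleteNormedModule)).
  intros; apply continuous_moment_integrand.
Qed.

Lemma is_RInt_moment (m a : nat) :
  is_RInt (fun t => t ^ a * sqrt (1 - t ^ m)) 0 1 (moment m a).
Proof.
  apply (RInt_correct (V := R_CompleteNormedModule)).
  apply ex_RInt_moment_integrand.
Qed.

Lemma moment_pos (m a : nat) : (1 <= m)%nat -> 0 < moment m a.
Proof.
  intros Hm; apply RInt_gt_0; [lra| |].
  - intros t Ht; assert (Hp := varpi_pow_bound m t Hm ltac:(lra)).
    apply Rmult_lt_0_compat; [apply pow_lt; lra | apply sqrt_lt_R0; lra].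
  - intros; apply continuous_moment_integrand.
Qed.

Lemma moment_decr (m a b : nat) : (a <= b)%nat -> moment m b <= moment m a.
Proof.
  intros Hab; apply RInt_le; [lra| apply ex_RInt_moment_integrand ..|].
  intros t Ht; apply Rmult_le_compat_r; [apply sqrt_pos|].
  replace b with (a + (b - a))%nat by lia; rewrite pow_add.
  assert (H1 : 0 <= t ^ a) by (apply pow_le; lra).
  assert (H2 : t ^ (b - a) <= 1)
    by (rewrite <- (pow1 (b - a)); apply pow_incr; lra).
  nra.
Qed.

(** The integrand is, up to a constant factor, the derivative of
    [(1 - t^m)^(3/2)]. *)
Lemma moment_pred (m : nat) : (1 <= m)%nat ->
  3 * INR m * moment m (pred m) = 2.
Proof.
  intros Hm.
  assert (HF : is_RInt
    (fun t => - (3 / 2 * INR m) * (t ^ pred m * sqrt (1 - t ^ m))) 0 1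
    (minus ((1 - 1 ^ m) * sqrt (1 - 1 ^ m)) ((1 - 0 ^ m) * sqrt (1 - 0 ^ m)))).
  { apply (is_RInt_derive (V := R_CompleteNormedModule)
             (fun t => (1 - t ^ m) * sqrt (1 - t ^ m))); intros t _.
    - apply is_derive_pow_three_halves.
    - apply (continuous_scal_r (K := R_AbsRing) (V := R_NormedModule)).
      apply continuous_moment_integrand. }
  assert (HK := is_RInt_scal (V := R_NormedModule) _ _ _ (- (3 / 2 * INR m)) _
                  (is_RInt_moment m (pred m))).
  assert (E := eq_trans (eq_sym (is_RInt_unique _ _ _ _ HK))
                        (is_RInt_unique _ _ _ _ HF)).
  rewrite pow1, pow_i, Rminus_0_r, sqrt_1 in E by lia.
  unfold scal, minus, plus, opp in E; simpl in E; unfold mult in E; simpl in E.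
  lra.
Qed.

(** The derivative of [t^(a+1) (1 - t^m)^(3/2)] is
    [(c1 t^a - c2 t^(a+m)) sqrt (1 - t^m)] with [c1 = a + 1] and
    [c2 = a + 1 + 3m/2], and the primitive vanishes at both endpoints. *)
Lemma moment_step (m a : nat) : (1 <= m)%nat ->
  (2 * INR a + 2) * moment m a = (2 * INR a + 2 + 3 * INR m) * moment m (a + m).
Proof.
  intros Hm.
  set (c1 := INR a + 1); set (c2 := INR a + 1 + 3 / 2 * INR m).
  assert (HK := is_RInt_minus (V := R_NormedModule) _ _ _ _ _ _
    (is_RInt_scal (V := R_NormedModule) _ _ _ c1 _ (is_RInt_moment m a))
    (is_RInt_scal (V := R_NormedModule) _ _ _ c2 _ (is_RInt_moment m (a + m)))).
  assert (HF := is_RInt_derive (V := R_CompleteNormedModule)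
    (fun t => t ^ S a * ((1 - t ^ m) * sqrt (1 - t ^ m)))
    (fun t => minus (scal c1 (t ^ a * sqrt (1 - t ^ m)))
                    (scal c2 (t ^ (a + m) * sqrt (1 - t ^ m)))) 0 1).
  cbv beta in HF.
  assert (E := fun H1 H2 => eq_trans (eq_sym (is_RInt_unique _ _ _ _ HK))
                        (is_RInt_unique _ _ _ _ (HF H1 H2))).
  lapply E; clear E HF HK; [intros E; lapply E; clear E; [intros E|]|].
  - rewrite pow1, pow_i in E by lia.
    unfold scal, minus, plus, opp in E; simpl in E; unfold mult in E; simpl in E.
    rewrite !pow1 in E; unfold c1, c2 in E; lra.
  - intros t _; apply (continuous_minus (V := R_NormedModule));
      apply (continuous_scal_r (K := R_AbsRing) (V := R_NormedModule));
      apply continuous_moment_integrand.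
  - intros t _.
    assert (Hpow : is_derive (fun t => t ^ S a) t (INR (S a) * t ^ a)).
    { replace (INR (S a) * t ^ a) with (INR (S a) * 1 * t ^ a) by ring.
      apply (is_derive_pow (fun t => t) (S a)).
      apply (is_derive_id (K := R_AbsRing)). }
    assert (HD := is_derive_mult (K := R_AbsRing) _ _ t _ _ Hpow
                    (is_derive_pow_three_halves m t) Rmult_comm).
    eapply eq_ind; [exact HD|].
    unfold scal, minus, plus, opp; simpl; unfold mult; simpl.
    destruct m as [|p]; [lia|].
    change (match a with 0%nat => 1 | S _ => INR a + 1 end) with (INR (S a)).
    rewrite S_INR; unfold c1, c2; rewrite pow_add; simpl pred; simpl pow.
    ring.
Qed.

(** * The improper integral in terms of a moment *)

Lemma is_RInt_gen_at_left (f G : R -> R) :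
  (forall b, 0 <= b < 1 -> is_RInt f 0 b (G b)) -> continuous G 1 ->
  is_RInt_gen f (at_point 0) (at_left 1) (G 1).
Proof.
  intros HI HG P HP.
  apply (Filter_prod _ _ _ (fun a => a = 0) (fun b => 0 <= b < 1 /\ P (G b))).
  - reflexivity.
  - unfold at_left, within.
    assert (H0 : locally 1 (fun b => 0 < b)) by (apply (open_gt 0); lra).
    assert (HP1 : locally 1 (fun b => P (G b))) by exact (HG P HP).
    generalize (filter_and _ _ H0 HP1); apply filter_imp.
    intros b [H1 H2] H3; split; [lra|exact H2].
  - intros a b -> [Hb Hb2]; exists (G b); split; [now apply HI|exact Hb2].
Qed.

(** With s = sqrt (1 - t^m), the identity t^m = 1 - s^2 turns the derivative
    of [t s] into [d = (1 + m/2) s - (m/2) / s]; solving for 1 / s gives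
    [1 / s = (1 + 2/m) s - (2/m) d], which is integrated from 0 to b.  The
    powers [t ^ 0] and [b ^ 1] keep the terms in the form of the integrand of
    [moment]. *)
Lemma is_RInt_inv_sqrt (m : nat) (b : R) : (1 <= m)%nat -> 0 <= b < 1 ->
  is_RInt (fun t => 1 / sqrt (1 - t ^ m)) 0 b
    ((1 + 2 / INR m) * RInt (fun t => t ^ 0 * sqrt (1 - t ^ m)) 0 b
     - 2 / INR m * (b ^ 1 * sqrt (1 - b ^ m))).
Proof.
  intros Hm Hb; assert (Hm0 : 0 < INR m) by (apply lt_0_INR; lia).
  set (s := fun t => t ^ 0 * sqrt (1 - t ^ m)).
  assert (Hs : forall t, 0 <= t < 1 -> 0 < sqrt (1 - t ^ m)).
  { intros t Ht; assert (Hp := varpi_pow_bound m t Hm Ht).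
    apply sqrt_lt_R0; lra. }
  set (d := fun t => minus (scal (1 + INR m / 2) (s t))
                           (scal (INR m / 2) (1 / sqrt (1 - t ^ m)))).
  assert (HD : is_RInt d 0 b
    (minus (b ^ 1 * sqrt (1 - b ^ m)) (0 ^ 1 * sqrt (1 - 0 ^ m)))).
  { apply (is_RInt_derive (V := R_CompleteNormedModule)
             (fun t => t ^ 1 * sqrt (1 - t ^ m)));
      intros t Ht; rewrite Rmin_left, Rmax_right in Ht by lra;
      assert (Hst := Hs t ltac:(lra));
      assert (Hp := varpi_pow_bound m t Hm ltac:(lra)).
    - assert (Hq : sqrt (1 - t ^ m) * sqrt (1 - t ^ m) = 1 - t ^ m)
        by (apply sqrt_sqrt; lra).
      assert (Hsq : is_derive (fun t => sqrt (1 - t ^ m)) t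
                (- (INR m * t ^ pred m) / (2 * sqrt (1 - t ^ m)))).
      { apply (is_derive_sqrt (fun t => 1 - t ^ m)); [|lra].
        apply is_derive_one_minus_pow. }
      assert (Hid : is_derive (fun t => t ^ 1) t (INR 1 * 1 * t ^ 0)).
      { apply (is_derive_pow (fun t => t) 1).
        apply (is_derive_id (K := R_AbsRing)). }
      assert (HM := is_derive_mult (K := R_AbsRing) _ _ t _ _ Hid Hsq Rmult_comm).
      eapply eq_ind; [exact HM|].
      unfold d, s, scal, minus, plus, opp, mult; simpl; unfold mult; simpl.
      replace (t * 1 * (- (INR m * t ^ pred m) / (2 * sqrt (1 - t ^ m))))
        with (- INR m * t ^ m / (2 * sqrt (1 - t ^ m))).
      2:{ destruct m as [|p]; [lia|]; simpl pred; simpl pow; field.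
          simpl in Hst; lra. }
      (* Only the numerator: occurrence 1 is under the first square root. *)
      replace (t ^ m) with (1 - sqrt (1 - t ^ m) * sqrt (1 - t ^ m))
        at 2 by (rewrite Hq; ring).
      field; lra.
    - apply (continuous_minus (V := R_NormedModule));
        apply (continuous_scal_r (K := R_AbsRing) (V := R_NormedModule)).
      + apply continuous_moment_integrand.
      + apply (ex_derive_continuous (V := R_NormedModule)).
        auto_derive; unfold Rminus in *; repeat split; lra. }
  assert (HS := RInt_correct (V := R_CompleteNormedModule) s 0 b
                  (ex_RInt_moment_integrand m 0 0 b)).
  assert (HC := is_RInt_minus (V := R_NormedModule) _ _ _ _ _ _
    (is_RInt_scal (V := R_NormedModule) _ _ _ (1 + 2 / INR m) _ HS)
    (is_RInt_scal (V := R_NormedModule) _ _ _ (2 / INR m) _ HD)).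
  replace (_ - _) with
    (minus (scal (1 + 2 / INR m) (RInt s 0 b))
       (scal (2 / INR m)
          (minus (b ^ 1 * sqrt (1 - b ^ m)) (0 ^ 1 * sqrt (1 - 0 ^ m))))).
  - revert HC; apply is_RInt_ext.
    intros t Ht; rewrite Rmin_left, Rmax_right in Ht by lra.
    assert (Hst := Hs t ltac:(lra)).
    unfold d, scal, minus, plus, opp; simpl; unfold mult; simpl.
    field; lra.
  - rewrite (pow_i 1) by lia.
    unfold scal, minus, plus, opp; simpl; unfold mult; simpl.
    ring.
Qed.

(** The primitive of the previous lemma extends continuously to b = 1, where
    its boundary term vanishes. *)
Lemma varpi_moment (m : nat) : (1 <= m)%nat ->
  varpi m = 2 * (1 + 2 / INR m) * moment m 0.
Proof.
  intros Hm.
  assert (HG := is_RInt_gen_at_left _ _ (fun b => is_RInt_inv_sqrt m b Hm)).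
  cbv beta in HG; unfold varpi; erewrite is_RInt_gen_unique; [|apply HG].
  - fold (moment m 0); rewrite !pow1, Rminus_diag, sqrt_0; ring.
  - apply (continuous_minus (V := R_NormedModule));
      apply (continuous_scal_r (K := R_AbsRing) (V := R_NormedModule)).
    + apply (continuous_RInt_1 (V := R_NormedModule)
               (fun t => t ^ 0 * sqrt (1 - t ^ m)) 0).
      apply filter_forall; intros z.
      apply (RInt_correct (V := R_CompleteNormedModule)).
      apply ex_RInt_moment_integrand.
    + apply continuous_moment_integrand.
Qed.

(** * The partial products *)

Definition factor (m n : nat) : R :=
  (2 * INR n * (2 * INR m * INR n + INR m + 2)) /
  ((2 * INR n + 1) * (2 * INR m * INR n + 2)).

(** Both recurrences telescope; denominators are cleared.  At N = 0 the identity
    is the value of [moment m (m - 1)]. *)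
Lemma partial_prod_moment (m N : nat) : (1 <= m)%nat ->
  partial_prod (factor m) N * (2 * INR m * INR N + 2) * moment m (m * N)
  = moment m 0 * (INR m * (2 * INR N + 3)) * moment m (m * N + pred m).
Proof.
  intros Hm; assert (Hm0 : 0 < INR m) by (apply lt_0_INR; lia).
  induction N as [|N IH].
  - assert (H := moment_pred m Hm).
    rewrite Nat.mul_0_r, Nat.add_0_l; simpl.
    replace (moment m 0 * (INR m * (2 * 0 + 3)) * moment m (pred m))
      with (moment m 0 * (3 * INR m * moment m (pred m))) by ring.
    rewrite H; ring.
  - assert (HN := pos_INR N).
    assert (HA := moment_step m (m * N) Hm).
    assert (HB := moment_step m (m * N + pred m) Hm).
    replace (m * N + pred m + m)%nat with (m * S N + pred m)%nat in HB by lia.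
    replace (m * N + m)%nat with (m * S N)%nat in HA by lia.
    assert (E : INR (m * N + pred m) = INR m * INR N + INR m - 1).
    { rewrite <- mult_INR, <- plus_INR.
      replace (m * N + m)%nat with (S (m * N + pred m)) by lia.
      rewrite S_INR; ring. }
    rewrite E in HB; clear E; rewrite mult_INR in HA.
    change (partial_prod (factor m) (S N))
      with (partial_prod (factor m) N * factor m (S N)).
    set (p := partial_prod (factor m) N) in *.
    set (K := moment m (m * N)) in *; set (K' := moment m (m * S N)) in *.
    set (L := moment m (m * N + pred m)) in *.
    set (L' := moment m (m * S N + pred m)) in *.
    unfold factor; rewrite S_INR.
    assert (Hpos : 0 <= INR m * INR N) by (apply Rmult_le_pos; lra).
    replace (moment m 0 * (INR m * (2 * (INR N + 1) + 3)) * L')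
      with (2 * (INR N + 1) / (2 * INR N + 3) *
            (moment m 0 * (INR m * (2 * INR N + 3)) * L)).
    + rewrite <- IH.
      replace (p * (2 * INR m * INR N + 2) * K)
        with (p * ((2 * (INR m * INR N) + 2) * K)) by ring.
      rewrite HA; field; nra.
    + assert (HB' : 2 * (INR N + 1) * L = (2 * INR N + 5) * L').
      { apply (Rmult_eq_reg_l (INR m)); [|lra]; lra. }
      replace (2 * (INR N + 1) + 3) with (2 * INR N + 5) by ring.
      transitivity (moment m 0 * INR m * (2 * (INR N + 1) * L)); [field; lra|].
      rewrite HB'; ring.
Qed.

(** By monotonicity of the moments, with x = mN, the partial product lies
    between [moment m 0] times (2x + 3m) / (2x + 2 + 3m) and [moment m 0] times
    (2x + 3m) / (2x + 2); the error term 3m / (N + 1) is a common weakening of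
    both that is easy to send to 0. *)
Lemma partial_prod_bound (m N : nat) : (1 <= m)%nat ->
  moment m 0 * (1 - 3 * INR m / (INR N + 1)) <= partial_prod (factor m) N
    <= moment m 0 * (1 + 3 * INR m / (INR N + 1)).
Proof.
  intros Hm; assert (Hm1 : 1 <= INR m) by (apply (le_INR 1); lia).
  assert (HN := pos_INR N).
  assert (Hpos : 0 <= INR m * INR N) by (apply Rmult_le_pos; lra).
  assert (E := partial_prod_moment m N Hm).
  assert (HS := moment_step m (m * N) Hm); rewrite mult_INR in HS.
  assert (H1 := moment_decr m (m * N) (m * N + pred m) ltac:(lia)).
  assert (H2 := moment_decr m (m * N + pred m) (m * N + m) ltac:(lia)).
  assert (HK := moment_pos m (m * N) Hm).
  assert (H0 := moment_pos m 0 Hm).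
  set (p := partial_prod (factor m) N) in *.
  set (x := INR m * INR N) in *.
  set (K := moment m (m * N)) in *; set (K' := moment m (m * N + m)) in *.
  set (L := moment m (m * N + pred m)) in *.
  replace (2 * INR m * INR N) with (2 * x) in E by (unfold x; ring).
  replace (INR m * (2 * INR N + 3)) with (2 * x + 3 * INR m) in E
    by (unfold x; ring).
  assert (Hup : p <= moment m 0 * ((2 * x + 3 * INR m) / (2 * x + 2))).
  { apply (Rmult_le_reg_r ((2 * x + 2) * K)); [nra|].
    replace (p * ((2 * x + 2) * K)) with (p * (2 * x + 2) * K) by ring.
    rewrite E.
    replace (moment m 0 * ((2 * x + 3 * INR m) / (2 * x + 2)) * ((2 * x + 2) * K))
      with (moment m 0 * (2 * x + 3 * INR m) * K) by (field; lra).
    apply Rmult_le_compat_l; [nra|exact H1]. }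
  assert (Hlo : moment m 0 * ((2 * x + 3 * INR m) / (2 * x + 2 + 3 * INR m)) <= p).
  { apply (Rmult_le_reg_r ((2 * x + 2) * K)); [nra|].
    replace (p * ((2 * x + 2) * K)) with (p * (2 * x + 2) * K) by ring.
    rewrite E, HS.
    replace (moment m 0 * ((2 * x + 3 * INR m) / (2 * x + 2 + 3 * INR m)) *
             ((2 * x + 2 + 3 * INR m) * K'))
      with (moment m 0 * (2 * x + 3 * INR m) * K') by (field; lra).
    apply Rmult_le_compat_l; [nra|exact H2]. }
  split.
  - eapply Rle_trans; [|exact Hlo]; apply Rmult_le_compat_l; [lra|].
    apply (Rmult_le_reg_r ((INR N + 1) * (2 * x + 2 + 3 * INR m))); [nra|].
    field_simplify; [|lra|lra]. unfold x in *; nra.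
  - eapply Rle_trans; [exact Hup|]; apply Rmult_le_compat_l; [lra|].
    apply (Rmult_le_reg_r ((INR N + 1) * (2 * x + 2))); [nra|].
    field_simplify; [|lra|lra]. unfold x in *; nra.
Qed.

Theorem mainTheorem1 : forall m : nat, (1 <= m)%nat ->
  exists P : R,
    is_inf_prod
      (fun n : nat =>
         (2 * INR n * (2 * INR m * INR n + INR m + 2)) /
         ((2 * INR n + 1) * (2 * INR m * INR n + 2))) P /\
    varpi m = 2 * (INR m + 2) / INR m * P.
Proof.
  intros m Hm; exists (moment m 0); split.
  - assert (H0 : is_lim_seq (fun N => 3 * INR m / (INR N + 1)) 0).
    { apply (is_lim_seq_ext (fun N => 3 * INR m * / INR (S N))).
      { intros N; now rewrite S_INR. }
      replace (Finite 0) with (Rbar_mult (3 * INR m) (Rbar_inv p_infty))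
        by (simpl; f_equal; ring).
      apply is_lim_seq_scal_l, is_lim_seq_inv; [|discriminate].
      apply (is_lim_seq_incr_1 INR), is_lim_seq_INR. }
    apply (is_lim_seq_le_le
             (fun N => moment m 0 * (1 - 3 * INR m / (INR N + 1))) _
             (fun N => moment m 0 * (1 + 3 * INR m / (INR N + 1)))).
    + intros N; exact (partial_prod_bound m N Hm).
    + replace (Finite (moment m 0)) with (Rbar_mult (moment m 0) (1 - 0))
        by (simpl; f_equal; ring).
      apply (is_lim_seq_scal_l _ (moment m 0) (1 - 0)).
      apply is_lim_seq_minus'; [apply is_lim_seq_const|exact H0].
    + replace (Finite (moment m 0)) with (Rbar_mult (moment m 0) (1 + 0))
        by (simpl; f_equal; ring).
      apply (is_lim_seq_scal_l _ (moment m 0) (1 + 0)).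
      apply is_lim_seq_plus'; [apply is_lim_seq_const|exact H0].
  - rewrite (varpi_moment m Hm); field.
    apply not_0_INR; lia.
Qed.
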